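(* Let $\mathcal{B}$ be a family of undirected graphs and let $\epsilon<2$ be a real number such that $\mathrm{ex}(n,\mathcal{B})=O(n^{2-\epsilon})$. Then there is a constant $c=c(\mathcal{B})>0$ such that for every digraph $G=(V,E)$ with $m$ edges whose underlying undirected graph $\overline{G}$ is $\mathcal{B}$-free, $$\beta(G)\le \frac{m}{2}-c\,m^{\frac34+\frac{\epsilon}{4(2-\epsilon)}}.$$
   Context: All digraphs are finite and oriented: no loops, no parallel edges, no antiparallel edges. The underlying undirected graph $\overline{G}$ is obtained by replacing each directed edge by an undirected edge. An undirected graph is $\mathcal{B}$-free if it contains no member of $\mathcal{B}$ as a (not necessarily induced) subgraph. The extremal number $\mathrm{ex}(n,\mathcal{B})$ is the maximum number of edges of a $\mathcal{B}$-free undirected (simple) graph on $n$ vertices. A feedback arc set of $G=(V,E)$ is a set $S\subset E$ such that $(V,E\setminus S)$ has no directed cycles; $\beta(G)$ is the minimum size of a feedback arc set. The exponent $\epsilon$ is a fixed number associated with $\mathcal{B}$ (the constant $c$ may depend on it). *)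

(* Defs.v *)
From mathcomp Require Import all_boot all_order all_algebra.
From mathcomp Require Import all_classical all_reals all_analysis.

Set Implicit Arguments.
Unset Strict Implicit.
Unset Printing Implicit Defensive.

(* Finite simple undirected graphs on T, given by their edge set. *)
Definition sgraph (T : finType) :=
  {E : {set {set T}} | [forall e in E, #|e| == 2]}.

(* Not necessarily induced subgraph containment: a copy of H in G. *)
Definition contains (T U : finType) (G : sgraph T) (H : sgraph U) : Prop :=
  exists f : U -> T,
    injective f /\ forall e : {set U}, e \in val H -> f @: e \in val G.

(* Possibly infinite, and not required to be closed under isomorphism. *)
Definition graph_family := forall U : finType, sgraph U -> Prop.

Definition family_free (B : graph_family) (T : finType) (G : sgraph T) : Prop :=
  forall (U : finType) (H : sgraph U), B U H -> ~ contains G H.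

(* The maximum over an empty collection is 0, which occurs when some member of
   B is an edgeless graph with at most n vertices. *)
Definition extremal_number (n : nat) (B : graph_family) : nat :=
  \max_(G : sgraph 'I_n | `[< family_free B G >]) #|val G|.

Definition oriented (T : finType) (A : {set T * T}) : bool :=
  [forall x, (x, x) \notin A] &&
  [forall x, forall y, ((x, y) \in A) ==> ((y, x) \notin A)].

(* The arc (x, y) goes from x to y. *)
Definition digraph (T : finType) := {A : {set T * T} | oriented A}.

Definition underlying_edges (T : finType) (A : {set T * T}) : {set {set T}} :=
  [set [set a.1; a.2] | a in A].

Lemma underlying_edgesP (T : finType) (G : digraph T) :
  [forall e in underlying_edges (val G), #|e| == 2].
Proof.
case: G => A /= /andP[/forallP loopless _].
apply/forall_inP => _ /imsetP[[x y] xyA ->] /=; rewrite cards2.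
by case: (eqVneq x y) xyA => //= ->; rewrite (negbTE (loopless y)).
Qed.

Definition underlying (T : finType) (G : digraph T) : sgraph T :=
  exist _ (underlying_edges (val G)) (underlying_edgesP G).

(* A directed cycle is a nonempty duplicate-free cyclic sequence of vertices. *)
Definition acyclic (T : finType) (A : {set T * T}) : Prop :=
  forall c : seq T, c != [::] -> ~ ucycle [rel x y | (x, y) \in A] c.

Definition feedback_arc_set (T : finType) (G : digraph T) (S : {set T * T}) :
    Prop :=
  S \subset val G /\ acyclic (val G :\: S).

(* The default value #|val G| is the size of the feedback arc set val G. *)
Definition beta (T : finType) (G : digraph T) : nat :=
  \big[minn/#|val G|]_(S : {set T * T} | `[< feedback_arc_set G S >]) #|S|.

(* Main.v *)
Require Import Defs.
From mathcomp Require Import all_boot all_order all_algebra.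
From mathcomp Require Import all_classical all_reals all_analysis.
From mathcomp Require Import ring lra zify.
Import Order.TTheory GRing.Theory Num.Theory.
Import numFieldNormedType.Exports.
Set Implicit Arguments.
Unset Strict Implicit.
Unset Printing Implicit Defensive.
Local Open Scope classical_set_scope.
Local Open Scope ring_scope.

(** Vertices are removed one at a time in some order.  When v is removed, the
    remaining arcs at v either all leave v or all enter v once the smaller of
    the two classes has been deleted, and a digraph in which this has been done
    for every vertex has no directed cycle.  If X_v denotes the difference
    between the two classes, the deleted arcs number m/2 - (sum_v |X_v|)/2
    ([beta_le_imbalance]).

    The order is randomised so that every |X_v| is large on average: take a
    uniformly random set A of vertices, remove the vertices of A and then the
    others, following one fixed enumeration within each part.  If v is in A,
    the neighbours of v that precede it in the enumeration remain exactly when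
    they lie outside A; if v is not in A, the same is true of the neighbours
    that follow it.  So X_v is, up to a constant, half a Rademacher sum over
    the preceding, respectively following, neighbours, and Khintchine's
    inequality ([khintchine]) bounds its mean absolute value below by a
    multiple of the square root of their number.  Averaging over A gives

      beta(G) <= m/2 - (5/128) S,   S = sum_v sqrt(deg v)

    ([beta_le_sum_sqrt_degree]), for every oriented graph.

    It remains to bound S below when every k vertices span at most C k^p arcs,
    where p = 2 - eps ([sum_sqrt_degree_ge]).  Let H be the set of vertices
    with sqrt(deg v) >= t.  Then |H| t <= S, and the arcs meeting the complement
    of H number at most the sum of t sqrt(deg v) over it, hence at most t S.
    For t = m / (2 S) this leaves at least m/2 arcs inside H, so that
    m/2 <= C (2 S^2 / m)^p, which rearranges to
    S >= c m^((1 + 1/p)/2).  The exponent (1 + 1/p)/2 is the one of the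
    theorem. *)

(** * Deleting the minority arcs along a removal order *)

Lemma beta_le_card (T : finType) (G : digraph T) (S : {set T * T}) :
  feedback_arc_set G S -> (beta G <= #|S|)%N.
Proof.
move=> SG; rewrite /beta -leEnat.
by apply: (@bigmin_le_cond _ _ _ _ S (fun S => `[< feedback_arc_set G S >])
  (fun S : {set T * T} => #|S|)); apply/asboolP.
Qed.

Lemma digraph_loopless (T : finType) (G : digraph T) x : (x, x) \notin val G.
Proof. by case: G => A /= /andP[/forallP]. Qed.

Lemma digraph_asym (T : finType) (G : digraph T) x y :
  (x, y) \in val G -> (y, x) \notin val G.
Proof. by case: G => A /= /andP[_ /forallP/(_ x)/forallP/(_ y)/implyP]. Qed.

(** With [r] as the removal time, each arc is judged by its endpoint that is
    removed first; [s v] tells that [v] keeps its outgoing rather than its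
    incoming arcs. *)
Definition majority_arcs (T : finType) (r : T -> nat) (s : pred T)
    (A : {set T * T}) : {set T * T} :=
  [set a in A | if (r a.1 < r a.2)%N then s a.1 else ~~ s a.2].

(** On a cycle, the vertex removed first would keep both the arc that enters it
    and the arc that leaves it. *)
Lemma majority_arcs_acyclic (T : finType) (r : T -> nat) (s : pred T)
    (G : digraph T) :
  injective r -> acyclic (majority_arcs r s (val G)).
Proof.
move=> r_inj [|x0 c] // _ /andP[cyc _].
have x0p : x0 \in x0 :: c by rewrite mem_head.
move: (x0 :: c) x0p cyc => p x0p cyc {c}.
have [x xp xmin] := arg_minnP r x0p.
have later y : y \in p -> y != x -> (r x < r y)%N.
  by move=> yp yx; rewrite ltn_neqAle xmin // andbT (inj_eq r_inj) eq_sym.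
have := next_cycle cyc xp; have := prev_cycle cyc xp.
rewrite /= !inE /= => /andP[prevG prevs] /andP[nextG nexts].
have nx : (r x < r (next p x))%N.
  apply: later; first by rewrite mem_next.
  by apply: contraL nextG => /eqP ->; exact: digraph_loopless.
have px : (r x < r (prev p x))%N.
  apply: later; first by rewrite mem_prev.
  by apply: contraL prevG => /eqP ->; exact: digraph_loopless.
by move: prevs nexts; rewrite nx ltnNge (ltnW px) /= => /negP.
Qed.

Section Orders.
Variables (R : realType) (T : finType) (G : digraph T).

Definition arc_sign (v u : T) : R :=
  ((v, u) \in val G)%:R - ((u, v) \in val G)%:R.

Definition imbalance (r : T -> nat) (v : T) : R :=
  \sum_(u | (r v < r u)%N) arc_sign v u.

(** Charging each arc to the endpoint removed first turns arc counts into sums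
    of local counts. *)
Lemma sum_arcs_by_first_endpoint (r : T -> nat) (F : T * T -> R) :
  injective r ->
  \sum_(a in val G) F a =
  \sum_v \sum_(u | (r v < r u)%N)
    (((v, u) \in val G)%:R * F (v, u) + ((u, v) \in val G)%:R * F (u, v)).
Proof.
move=> r_inj.
pose g v u := ((v, u) \in val G)%:R * F (v, u).
transitivity (\sum_v \sum_u g v u).
  rewrite pair_big /= big_mkcond /=; apply: eq_bigr => -[v u] _ /=.
  by rewrite /g; case: (_ \in _); rewrite (mul1r, mul0r).
under [RHS]eq_bigr => v _ do rewrite big_split /=.
rewrite big_split /= [X in _ + X](exchange_big_dep xpredT) //= -big_split /=.
apply: eq_bigr => v _.
rewrite (bigID (fun u => (r v < r u)%N)) /=; congr (_ + _).
rewrite (bigID (fun u => (r u < r v)%N)) /= [X in _ + X]big1 ?addr0.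
  by apply: eq_bigl => u; case: ltngtP.
move=> u; case: ltngtP => // /r_inj -> _.
by rewrite /g (negbTE (digraph_loopless _ _)) mul0r.
Qed.

(** Keeping the majority at [v] deletes min(o, i) = (o + i - |o - i|) / 2 arcs,
    where o and i count the outgoing and incoming arcs at [v] that remain. *)
Lemma beta_le_imbalance (r : T -> nat) :
  injective r ->
  (beta G)%:R <= #|val G|%:R / 2 - (\sum_v `|imbalance r v|) / 2 :> R.
Proof.
move=> r_inj; pose s v := 0 <= imbalance r v.
pose K := majority_arcs r s (val G).
have fas : feedback_arc_set G (val G :\: K).
  split; first exact: finset.subsetDl.
  rewrite finset.setDDr finset.setDv finset.set0U (finset.setIidPr _);
    last by apply/fintype.subsetP => a; rewrite inE => /andP[].
  exact: majority_arcs_acyclic.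
apply: le_trans (_ : #|val G :\: K|%:R <= _).
  by rewrite ler_nat; apply: beta_le_card.
have -> : #|val G :\: K|%:R = \sum_(a in val G) (a \notin K)%:R :> R.
  rewrite -sum1_card natr_sum big_mkcond [RHS]big_mkcond /=.
  apply: eq_bigr => a _; rewrite finset.in_setD.
  by case: (a \in K); case: (a \in val G).
have -> : #|val G|%:R = \sum_(a in val G) 1 :> R.
  by rewrite -sum1_card natr_sum.
rewrite !(@sum_arcs_by_first_endpoint r) // !mulr_suml -sumrB.
apply: ler_sum => v _.
pose o : R := \sum_(u | (r v < r u)%N) ((v, u) \in val G)%:R.
pose i : R := \sum_(u | (r v < r u)%N) ((u, v) \in val G)%:R.
have Xoi : imbalance r v = o - i by rewrite /imbalance sumrB.
have -> : \sum_(u | (r v < r u)%N)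
   (((v, u) \in val G)%:R * 1 + ((u, v) \in val G)%:R * 1) = o + i :> R.
  by rewrite -big_split; apply: eq_bigr => u _; rewrite !mulr1.
have -> : \sum_(u | (r v < r u)%N)
   (((v, u) \in val G)%:R * ((v, u) \notin K)%:R +
    ((u, v) \in val G)%:R * ((u, v) \notin K)%:R) =
    if s v then i else o :> R.
  rewrite -fun_if /= /o /i; case: ifPn => sv; apply: eq_bigr => u vu;
    rewrite !finset.in_set /= vu [(r u < r v)%N]ltnNge (ltnW vu) /= ?sv ?(negbTE sv);
    by do 2!case: (_ \in _); rewrite /= ?mulr0 ?mulr1 ?addr0 ?add0r.
rewrite Xoi; case: ifPn; rewrite /s Xoi => h.
  by rewrite ger0_norm //; lra.
by rewrite ltr0_norm ?ltNge //; lra.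
Qed.

End Orders.

(** * Khintchine's inequality for a uniformly random set *)

Section Rademacher.
Variables (R : realType) (T : finType).
Implicit Types (A N : {set T}) (s : T -> R).

(** A uniformly random [A] makes the [coin A u] independent Rademacher signs;
    means are written as sums over all [A]. *)
Definition coin A (u : T) : R := if u \in A then 1 else -1.

Definition signed_sum s N A : R := \sum_(u in N) s u * coin A u.

(** Toggling one element is the measure-preserving involution that stands for
    the independence and the symmetry of one sign. *)
Definition flip (w : T) A : {set T} := if w \in A then A :\ w else w |: A.

Lemma in_flip w A u : (u \in flip w A) = (u \in A) (+) (u == w).
Proof.
rewrite /flip; case: ifPn => wA; rewrite !inE;
by case: eqVneq => [->|] //=; rewrite ?wA ?(negbTE wA) ?addbF.
Qed.

Lemma flipK w : involutive (flip w).
Proof. by move=> A; apply/finset.setP=> u; rewrite !in_flip -addbA addbb addbF. Qed.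

Lemma coin_flip w A u : coin (flip w A) u = if u == w then - coin A u else coin A u.
Proof.
rewrite /coin in_flip; case: eqVneq => [->|_]; last by rewrite addbF.
by rewrite addbT; case: (w \in A); rewrite /= ?opprK.
Qed.

Lemma coin_sqr A u : coin A u ^+ 2 = 1.
Proof. by rewrite /coin; case: ifP; rewrite ?sqrrN expr1n. Qed.

Lemma coinC A u : coin (~: A) u = - coin A u.
Proof. by rewrite /coin inE; case: (u \in A); rewrite /= ?opprK. Qed.

Lemma signed_sum_flip s w N A : w \notin N ->
  signed_sum s N (flip w A) = signed_sum s N A.
Proof.
move=> wN; apply: eq_bigr => u uN; rewrite coin_flip.
by case: eqVneq uN => // ->; rewrite (negbTE wN).
Qed.

Lemma sum_coin_independent (w : T) (f : {set T} -> R) :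
  (forall A, f (flip w A) = f A) -> \sum_A f A * coin A w = 0.
Proof.
move=> fw; set S := \sum_A _.
suff : S = - S by lra.
rewrite {1}/S (reindex_inj (inv_inj (flipK w))) -sumrN.
by apply: eq_bigr => A _; rewrite fw coin_flip eqxx mulrN.
Qed.

(** Conditioning on a fair coin that is independent of the two outcomes. *)
Lemma sum_coin_cases (w : T) (f g : {set T} -> R) :
  (forall A, f (flip w A) = f A) -> (forall A, g (flip w A) = g A) ->
  \sum_(A : {set T}) (if w \in A then f A else g A) = 2^-1 * (\sum_A f A + \sum_A g A).
Proof.
move=> fw gw.
transitivity (\sum_(A : {set T}) (2^-1 * (f A + g A) + 2^-1 * ((f A - g A) * coin A w))).
  by apply: eq_bigr => A _; rewrite /coin; case: ifP => _; field.
rewrite big_split /= -!mulr_sumr (sum_coin_independent (w := w)).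
  by rewrite mulr0 addr0 big_split.
by move=> A; rewrite fw gw.
Qed.

(** Adding one sign z to a sum Y adds 1 to the second moment and 6 Y^2 + 1 to
    the fourth, as the terms that are odd in z average out; the bound follows
    from 3 k^2 + 6 k + 1 <= 3 (k + 1)^2. *)
Lemma signed_sum_moments s N : {in N, forall u, s u ^+ 2 = 1} ->
  \sum_A signed_sum s N A ^+ 2 = #|N|%:R * #|{set T}|%:R /\
  \sum_A signed_sum s N A ^+ 4 <= 3 * #|N|%:R ^+ 2 * #|{set T}|%:R.
Proof.
move: {2}#|N| (erefl #|N|) => n; elim: n N => [|n IH] N cN sN.
  move/cards0_eq: cN => ->; rewrite cards0 /signed_sum.
  by rewrite !big1 => [|A _|A _]; rewrite ?big_set0 expr0n //= mulr0 !mul0r.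
have [w wN] : exists w, w \in N by apply/card_gt0P; rewrite cN.
have cN' : #|N :\ w| = n by move: cN; rewrite (cardsD1 w) wN => -[].
have sN' : {in N :\ w, forall u, s u ^+ 2 = 1}.
  by move=> u /setD1P[_ /sN].
have wN' : w \notin N :\ w by rewrite !inE eqxx.
have [IH2 IH4] := IH _ cN' sN'.
rewrite cN -[n.+1]addn1 natrD; rewrite cN' in IH2 IH4.
pose Y := signed_sum s (N :\ w).
have YE A : signed_sum s N A = Y A + s w * coin A w.
  by rewrite /signed_sum (big_setD1 w) //= addrC.
have z2 A : (s w * coin A w) ^+ 2 = 1 by rewrite exprMn coin_sqr sN // mulr1.
have cross k : \sum_A Y A ^+ k * (s w * coin A w) = 0.
  under eq_bigr => A _ do rewrite mulrA.
  by apply: sum_coin_independent => A; rewrite /Y signed_sum_flip.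
have one : \sum_(A : {set T}) 1 = #|{set T}|%:R :> R by rewrite sumr_const.
split.
  rewrite mulrDl mul1r -IH2 -one.
  under eq_bigr => A _.
    rewrite YE sqrrD z2 -(expr1 (Y A)) -exprM mulr2n; over.
  by rewrite !big_split /= !cross !addr0.
apply: le_trans (_ : 3 * n%:R ^+ 2 * #|{set T}|%:R
  + 6 * (n%:R * #|{set T}|%:R) + #|{set T}|%:R <= _); last first.
  by have : 0 <= #|{set T}|%:R :> R; [exact: ler0n|nra].
rewrite -IH2 -{2}one mulr_sumr.
have -> : \sum_A signed_sum s N A ^+ 4 = \sum_A Y A ^+ 4
   + 4 * (\sum_A Y A ^+ 3 * (s w * coin A w))
   + \sum_A 6 * Y A ^+ 2 + 4 * (\sum_A Y A ^+ 1 * (s w * coin A w))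
   + \sum_(A : {set T}) 1.
  rewrite !mulr_sumr -!big_split /=; apply: eq_bigr => A _.
  rewrite YE; move: (z2 A); set z := s w * _ => zz.
  have z3 : z ^+ 3 = z by rewrite exprS zz mulr1.
  have z4 : z ^+ 4 = 1 by rewrite (exprM z 2 2) zz expr1n.
  transitivity (Y A ^+ 4 + 4 * (Y A ^+ 3 * z) + 6 * Y A ^+ 2 * z ^+ 2
    + 4 * (Y A ^+ 1 * z ^+ 3) + z ^+ 4); first by ring.
  by rewrite zz z3 z4 mulr1.
by rewrite !cross mulr0 !addr0 !lerD2r.
Qed.

(** The shift [a] can be dropped because the sum Y is symmetric and
    |a + Y| + |a - Y| >= 2 |Y|.  For the centred sum, a polynomial
    q^-1 Y^2 / 2 - q^-3 Y^4 / 16 with q = sqrt #|N| lies below |Y|, and its mean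
    is controlled by the second and fourth moments. *)
Lemma khintchine s N (a : R) : {in N, forall u, s u ^+ 2 = 1} ->
  5 / 16 * Num.sqrt #|N|%:R * #|{set T}|%:R <= \sum_A `|a + signed_sum s N A|.
Proof.
move=> sN; set n := #|{set T}|%:R : R.
have n0 : 0 <= n by exact: ler0n.
pose Y := signed_sum s N.
have YC A : Y (~: A) = - Y A.
  by rewrite /Y /signed_sum -sumrN; apply: eq_bigr => u _; rewrite coinC mulrN.
apply: (@le_trans _ _ (\sum_A `|Y A|)); last first.
  suff : (\sum_A `|Y A|) * 2 <= (\sum_A `|a + Y A|) * 2 by lra.
  have -> : (\sum_A `|a + Y A|) * 2 = \sum_A (`|a + Y A| + `|a - Y A|).
    rewrite big_split /= mulr_natr mulr2n; congr (_ + _).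
    by rewrite (reindex_inj (@finset.setC_inj _)); apply: eq_bigr => A _; rewrite YC.
  rewrite mulr_suml; apply: ler_sum => A _.
  rewrite (_ : `|Y A| * 2 = `|(a + Y A) - (a - Y A)|); first exact: ler_normB.
  by rewrite (_ : _ - _ = Y A * 2) ?normrM ?(ger0_norm (ler0n _ 2)) //; ring.
have [->|/set0Pn [u0 uN]] := eqVneq N finset.set0.
  by rewrite cards0 sqrtr0 mulr0 mul0r sumr_ge0.
have [M2 M4] := signed_sum_moments sN.
have k0 : 0 < #|N|%:R :> R by rewrite ltr0n; apply/card_gt0P; exists u0.
set k := #|N|%:R : R in M2 M4 k0 *; set q := Num.sqrt k.
have q0 : 0 < q by rewrite sqrtr_gt0.
have qk : q ^+ 2 = k by rewrite sqr_sqrtr // ltW.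
have pw A : q ^- 1 / 2 * Y A ^+ 2 - q ^- 3 / 16 * Y A ^+ 4 <= `|Y A|.
  have [t t0 tE] : exists2 t, 0 <= t & `|Y A| = q * t.
    exists (q^-1 * `|Y A|); first by rewrite mulr_ge0 // invr_ge0 ltW.
    by rewrite mulVKf // gt_eqF.
  have -> : Y A ^+ 2 = (q * t) ^+ 2 by rewrite -tE real_normK // num_real.
  have -> : Y A ^+ 4 = (q * t) ^+ 4.
    by rewrite -tE !(exprM _ 2 2) real_normK // num_real.
  rewrite tE (_ : _ - _ = q * (t ^+ 2 / 2 - t ^+ 4 / 16)); last first.
    by field; rewrite gt_eqF.
  rewrite ler_pM2l // -subr_ge0.
  (* After scaling by q, this is the positivity of t^3 - 8 t + 16 on t >= 0. *)
  rewrite (_ : _ - _ = t * (t * (t - 2) ^+ 2 + (2 * t - 3) ^+ 2 + 7) / 16); last by field.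
  have t2 : 0 <= t * (t - 2) ^+ 2 by rewrite mulr_ge0 ?sqr_ge0.
  have t3 := sqr_ge0 (2 * t - 3).
  by rewrite divr_ge0 // mulr_ge0 //; lra.
apply: (@le_trans _ _
  (\sum_A (q ^- 1 / 2 * Y A ^+ 2 - q ^- 3 / 16 * Y A ^+ 4))); last exact: ler_sum.
rewrite sumrB -!mulr_sumr M2.
have : q ^- 3 / 16 * (\sum_A Y A ^+ 4) <= q ^- 3 / 16 * (3 * k ^+ 2 * n).
  by rewrite ler_wpM2l // mulr_ge0 // invr_ge0 exprn_ge0 // ltW.
rewrite -qk -/n.
have -> : q ^- 3 / 16 * (3 * (q ^+ 2) ^+ 2 * n) = 3 / 16 * (q * n).
  by field; rewrite gt_eqF.
have -> : q ^- 1 / 2 * (q ^+ 2 * n) = 1 / 2 * (q * n).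
  by field; rewrite gt_eqF.
by rewrite -!mulrA; lra.
Qed.

End Rademacher.

(** * The random removal order *)

Section SplitOrder.
Variables (R : realType) (T : finType) (G : digraph T).
Implicit Types (A : {set T}) (u v : T).

Definition neighbours v : {set T} :=
  [set u | ((v, u) \in val G) || ((u, v) \in val G)].

Definition degree v : nat := #|neighbours v|.

(** The offset is larger than every rank, so all of [A] precedes its
    complement. *)
Definition split_order A v : nat := enum_rank v + (v \notin A) * #|T|.

Lemma split_order_lt A v u :
  (split_order A v < split_order A u)%N =
  if v \in A then (u \notin A) || (enum_rank v < enum_rank u)%N
  else (u \notin A) && (enum_rank v < enum_rank u)%N.
Proof.
rewrite /split_order; have rT w : (enum_rank w < #|T|)%N := ltn_ord (enum_rank w).
have := rT v; have := rT u.
by case: (v \in A); case: (u \in A) => /=; lia.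
Qed.

Lemma split_order_inj A : injective (split_order A).
Proof.
move=> u v; rewrite /split_order => uv; apply/enum_rank_inj/val_inj => /=.
have rT w : (enum_rank w < #|T|)%N := ltn_ord (enum_rank w).
have := rT v; have := rT u.
by move: uv; case: (v \in A); case: (u \in A) => /=; lia.
Qed.

Lemma arc_sign_sqr v u : u \in neighbours v -> arc_sign R G v u ^+ 2 = 1.
Proof.
rewrite finset.in_set /arc_sign; have := @digraph_asym _ G v u.
case: ((v, u) \in val G) => [/(_ isT) /negbTE -> _|_ /= ->].
  by rewrite subr0 expr1n.
by rewrite sub0r sqrrN expr1n.
Qed.

Lemma arc_sign_nonneighbour v u : u \notin neighbours v -> arc_sign R G v u = 0.
Proof.
by rewrite finset.in_set negb_or /arc_sign => /andP[/negbTE -> /negbTE ->]; rewrite subrr.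
Qed.

Lemma neighbours_irrefl v : v \notin neighbours v.
Proof. by rewrite finset.in_set orbb digraph_loopless. Qed.

Definition earlier v := [set u in neighbours v | (enum_rank u < enum_rank v)%N].
Definition later v := [set u in neighbours v | (enum_rank v < enum_rank u)%N].

Lemma degree_split v : degree v = (#|earlier v| + #|later v|)%N.
Proof.
rewrite /degree -(cardsID (earlier v)).
congr (_ + _)%N; apply: eq_card => u.
  by rewrite !finset.inE; case: (_ || _).
have := neighbours_irrefl v; rewrite !finset.inE.
case: ltngtP => [||/val_inj/enum_rank_inj ->]; rewrite ?andbT ?andbF //=.
  by rewrite andNb.
by move/negbTE ->.
Qed.

(** The indicator of u outside A is (1 - coin A u) / 2, so a sum over the
    surviving neighbours is an affine function of a Rademacher sum. *)
Lemma sum_tails v (P : pred T) (N : {set T}) A :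
  {in neighbours v, forall u, P u = (u \in N)} -> N \subset neighbours v ->
  \sum_(u | (u \notin A) && P u) arc_sign R G v u =
  2^-1 * (\sum_(u in N) arc_sign R G v u - signed_sum (arc_sign R G v) N A).
Proof.
move=> PN /fintype.subsetP Nv.
rewrite /signed_sum -sumrB mulr_sumr big_mkcond [RHS]big_mkcond /=.
apply: eq_bigr => u _; rewrite /coin.
have [uv|uv] := boolP (u \in neighbours v).
  rewrite PN //; case: (u \in N); last by rewrite andbF.
  by case: (u \in A) => /=; rewrite ?mulr1 ?subrr ?mulr0 //; field.
have /negbTE -> : u \notin N by apply: contra uv; apply: Nv.
by rewrite arc_sign_nonneighbour // if_same.
Qed.

Lemma imbalance_split_in A v : v \in A ->
  imbalance R G (split_order A) v =
  \sum_(u | (enum_rank v < enum_rank u)%N) arc_sign R G v u +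
  2^-1 * (\sum_(u in earlier v) arc_sign R G v u
          - signed_sum (arc_sign R G v) (earlier v) A).
Proof.
move=> vA.
rewrite -(@sum_tails v (fun u => ~~ (enum_rank v < enum_rank u)%N)); last first.
- by apply/fintype.subsetP => u; rewrite finset.in_set => /andP[].
- move=> u uv; rewrite finset.in_set uv /= -leqNgt leq_eqVlt.
  case: eqVneq => // /val_inj/enum_rank_inj E.
  by move: uv; rewrite E (negbTE (neighbours_irrefl v)).
rewrite /imbalance (bigID (fun u => (enum_rank v < enum_rank u)%N)) /=.
congr (_ + _); apply: eq_bigl => u; rewrite split_order_lt vA.
  by rewrite andb_idl // => ->; rewrite orbT.
by case: (_ < _)%N; rewrite ?andbF ?orbF.
Qed.

Lemma imbalance_split_notin A v : v \notin A ->
  imbalance R G (split_order A) v =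
  2^-1 * (\sum_(u in later v) arc_sign R G v u
          - signed_sum (arc_sign R G v) (later v) A).
Proof.
move=> vA.
rewrite -(@sum_tails v (fun u => (enum_rank v < enum_rank u)%N)); last first.
- by apply/fintype.subsetP => u; rewrite finset.in_set => /andP[].
- by move=> u uv; rewrite finset.in_set uv.
by apply: eq_bigl => u; rewrite split_order_lt (negbTE vA).
Qed.

(** The membership of [v] is independent of the other signs, so each of its two
    cases has weight 1/2; each contributes the square root of the number of
    neighbours on one side of [v] in the enumeration, and
    sqrt(x + y) <= sqrt x + sqrt y combines them. *)
Lemma mean_imbalance v :
  5 / 64 * Num.sqrt (degree v)%:R * #|{set T}|%:R <=
  \sum_A `|imbalance R G (split_order A) v|.
Proof.
pose a : R := \sum_(u | (enum_rank v < enum_rank u)%N) arc_sign R G v u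
  + 2^-1 * \sum_(u in earlier v) arc_sign R G v u.
pose b : R := 2^-1 * \sum_(u in later v) arc_sign R G v u.
pose X1 A := 2^-1 * `|- 2 * a + signed_sum (arc_sign R G v) (earlier v) A|.
pose X2 A := 2^-1 * `|- 2 * b + signed_sum (arc_sign R G v) (later v) A|.
have half x y : `|x - 2^-1 * y| = 2^-1 * `|- 2 * x + y| :> R.
  rewrite -{2}(@ger0_norm _ (2^-1 : R)) // -normrM -normrN; congr `|_|.
  by field.
have vE : v \notin earlier v by rewrite finset.in_set (negbTE (neighbours_irrefl v)).
have vL : v \notin later v by rewrite finset.in_set (negbTE (neighbours_irrefl v)).
have -> : \sum_A `|imbalance R G (split_order A) v| =
    \sum_(A : {set T}) (if v \in A then X1 A else X2 A).
  apply: eq_bigr => A _; rewrite /X1 /X2 -!half; case: ifPn => vA.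
    by rewrite imbalance_split_in // mulrBr addrA.
  by rewrite imbalance_split_notin // mulrBr.
rewrite sum_coin_cases; last 2 first.
- by move=> A; rewrite /X1 signed_sum_flip.
- by move=> A; rewrite /X2 signed_sum_flip.
rewrite /X1 /X2 -!mulr_sumr.
have sE : {in earlier v, forall u, arc_sign R G v u ^+ 2 = 1}.
  by move=> u; rewrite finset.in_set => /andP[/arc_sign_sqr].
have sL : {in later v, forall u, arc_sign R G v u ^+ 2 = 1}.
  by move=> u; rewrite finset.in_set => /andP[/arc_sign_sqr].
have := khintchine (- 2 * a) sE; have := khintchine (- 2 * b) sL.
have : Num.sqrt (degree v)%:R * #|{set T}|%:R <=
    Num.sqrt #|earlier v|%:R * #|{set T}|%:R +
    Num.sqrt #|later v|%:R * #|{set T}|%:R :> R.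
  rewrite -mulrDl ler_wpM2r // degree_split natrD.
  rewrite -ler_sqr ?nnegrE ?addr_ge0 ?sqrtr_ge0 // sqrrD !sqr_sqrtr ?addr_ge0 //.
  by rewrite lerD2r lerDl mulrn_wge0 // mulr_ge0 ?sqrtr_ge0.
by rewrite -!mulrA; lra.
Qed.

(** The bound of [beta_le_imbalance] holds for every [A], hence on average. *)
Lemma beta_le_sum_sqrt_degree :
  (beta G)%:R <=
  #|val G|%:R / 2 - 5 / 128 * \sum_v Num.sqrt (degree v)%:R :> R.
Proof.
set n := #|{set T}|%:R : R.
have n0 : 0 < n by rewrite ltr0n; apply/card_gt0P; exists finset.set0.
rewrite -(ler_pM2r n0).
have sumc (x : R) : \sum_(A : {set T}) x = x * n by rewrite sumr_const mulr_natr.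
rewrite -sumc; apply: le_trans
  (_ : \sum_(A : {set T}) (#|val G|%:R / 2
       - (\sum_v `|imbalance R G (split_order A) v|) / 2) <= _).
  by apply: ler_sum => A _; apply: beta_le_imbalance; exact: split_order_inj.
rewrite sumrB sumc -mulr_suml exchange_big /= mulrBl lerD2l lerN2.
have : \sum_v (5 / 64 * Num.sqrt (degree v)%:R * n) <=
    \sum_v \sum_A `|imbalance R G (split_order A) v|.
  by apply: ler_sum => v _; exact: mean_imbalance.
rewrite -mulr_suml -mulr_sumr.
lra.
Qed.

End SplitOrder.

(** * Counting arcs of a graph with few edges in every vertex set *)

Definition arcs_within (T : finType) (G : digraph T) (H : {set T}) : {set T * T} :=
  [set a in val G | (a.1 \in H) && (a.2 \in H)].

(** Antiparallel arcs being excluded, arcs can be counted as undirected edges. *)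
Lemma arc_ends_inj (T : finType) (G : digraph T) :
  {in val G &, injective (fun a : T * T => [set a.1; a.2]%SET)}.
Proof.
move=> [x y] [z w] /= xyG zwG e.
have nxy : x != y by apply: contraTneq xyG => ->; exact: digraph_loopless.
have : x \in [set z; w]%SET by rewrite -e finset.set21.
have : y \in [set z; w]%SET by rewrite -e finset.set22.
rewrite !finset.in_set2 => /orP[] /eqP ey /orP[] /eqP ex; subst.
- by rewrite eqxx in nxy.
- by move: xyG; rewrite (negbTE (digraph_asym zwG)).
- by [].
- by rewrite eqxx in nxy.
Qed.

(** The subgraph induced on [H], relabelled by an initial segment of the
    naturals, inherits freeness from the whole graph. *)
Lemma card_arcs_within (B : graph_family) (T : finType) (G : digraph T)
    (H : {set T}) :
  family_free B (underlying G) ->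
  (#|arcs_within G H| <= extremal_number #|H| B)%N.
Proof.
move=> Bfree; pose f : 'I_#|H| -> T := enum_val.
have f_inj : injective f by exact: enum_val_inj.
pose E : {set {set 'I_#|H|}} :=
  [set e : {set 'I_#|H|} | f @: e \in underlying_edges (val G)]%SET.
have EP : [forall e in E, #|e| == 2].
  apply/forall_inP => e; rewrite finset.in_set => eG.
  by have /forall_inP/(_ _ eG) := underlying_edgesP G; rewrite card_imset.
pose K : sgraph 'I_#|H| := exist _ E EP.
have Kfree : family_free B K.
  move=> U L BL [g [g_inj gE]]; apply: (Bfree U L BL).
  exists (f \o g); split; first exact: inj_comp.
  move=> e /gE eE; have : g @: e \in E := eE.
  by rewrite finset.in_set (imset_comp f g).
apply: leq_trans (_ : #|E| <= _)%N; last first.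
  rewrite /extremal_number; apply: (@leq_bigmax_cond _
    (fun K => `[< family_free B K >]) (fun K : sgraph 'I_#|H| => #|val K|) K).
  exact/asboolP.
have /card_in_imset <- :
    {in arcs_within G H &, injective (fun a : T * T => [set a.1; a.2]%SET)}.
  by move=> a b; rewrite !finset.in_set => /andP[aG _] /andP[bG _];
    exact: (arc_ends_inj aG bG).
apply: leq_trans (leq_imset_card (fun e : {set _} => f @: e) E).
apply/subset_leq_card/fintype.subsetP => _ /imsetP[[x y] xyH ->] /=.
move: xyH; rewrite finset.in_set /= => /and3P[xyG xH yH].
have e : f @: [set enum_rank_in xH x; enum_rank_in xH y]%SET = [set x; y]%SET.
  by rewrite imsetU1 imset_set1 /f !enum_rankK_in.
apply/imsetP; exists [set enum_rank_in xH x; enum_rank_in xH y]%SET => //.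
by rewrite finset.in_set e; apply/imsetP; exists (x, y).
Qed.

Lemma degreeE (T : finType) (G : digraph T) v :
  degree G v = (\sum_u (((v, u) \in val G) + ((u, v) \in val G)))%N.
Proof.
rewrite /degree -sum1_card big_mkcond /=; apply: eq_bigr => u _.
rewrite finset.in_set; have := @digraph_asym _ G v u.
by case: ((v, u) \in val G) => [/(_ isT)/negbTE ->|_] //; case: (_ \in val G).
Qed.

(** An arc that is not inside [H] is counted by the degree of an endpoint
    outside [H]. *)
Lemma card_arcs_le (T : finType) (G : digraph T) (H : {set T}) :
  (#|val G| <= #|arcs_within G H| + \sum_(v | v \notin H) degree G v)%N.
Proof.
rewrite -!sum1_card.
have pairE (P : pred (T * T)) :
    (\sum_(a | P a) 1 = \sum_v \sum_u (P (v, u) : nat))%N.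
  by rewrite pair_big big_mkcond /=; apply: eq_bigr => -[v u] _ /=; case: (P _).
rewrite !pairE.
have -> : (\sum_(v | v \notin H) degree G v =
    \sum_v \sum_u ((v \notin H) + (u \notin H)) * ((v, u) \in val G))%N.
  transitivity (\sum_v \sum_u ((v \notin H) * ((v, u) \in val G)
    + (v \notin H) * ((u, v) \in val G)))%N.
    rewrite big_mkcond /=; apply: eq_bigr => v _; rewrite degreeE.
    case: (v \notin H); last by rewrite big1.
    by apply: eq_bigr => u _; rewrite !mul1n.
  under eq_bigr => v _ do rewrite big_split /=.
  rewrite big_split /= [X in (_ + X)%N]exchange_big /= -big_split.
  apply: eq_bigr => v _ /=; rewrite -big_split; apply: eq_bigr => u _ /=.
  by rewrite mulnDl.
rewrite -big_split; apply: leq_sum => v _; rewrite -big_split; apply: leq_sum => u _ /=.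
by rewrite finset.in_set /=; case: (_ \in val G); case: (v \in H); case: (u \in H).
Qed.

(** The finitely many orders below the threshold of the big-O are absorbed in
    the constant, since n^p >= 1 for positive n and p. *)
Lemma extremal_power_bound (R : realType) (B : graph_family) (p : R) : 0 < p ->
  (fun n : nat => (extremal_number n B)%:R : R) =O_\oo
    (fun n : nat => n%:R `^ p) ->
  exists2 C : R, 0 < C &
    forall n, (0 < n)%N -> (extremal_number n B)%:R <= C * n%:R `^ p.
Proof.
move=> p0 /eqO_exP[C [C0 [N _ CN]]].
pose M : R := \sum_(i < N) (extremal_number i B)%:R.
have M0 : 0 <= M by exact: sumr_ge0.
exists (C + M) => [|n n0]; first by rewrite ltr_wpDr.
have n1 : 1 <= n%:R `^ p.
  by rewrite -[leLHS](powRr0 n%:R) ler_powR ?ler1n // ltW.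
have [Nn|nN] := leqP N n.
  have := CN n Nn; rewrite /= !ger0_norm ?powR_ge0 // => /le_trans -> //.
  by rewrite ler_wpM2r ?powR_ge0 // lerDl.
apply: (@le_trans _ _ M).
  by rewrite /M (bigD1 (Ordinal nN)) //= lerDl sumr_ge0.
rewrite -[M in leLHS]mulr1 ler_pM // lerDr ltW //.
Qed.

(** If S were small, few vertices would have a large degree, and these would
    span few arcs; but the vertices of small degree cannot carry m/2 arcs
    either. *)
Lemma sum_sqrt_degree_ge (R : realType) (B : graph_family) (p C : R)
    (T : finType) (G : digraph T) :
  0 < p -> 0 < C ->
  (forall n, (0 < n)%N -> (extremal_number n B)%:R <= C * n%:R `^ p) ->
  family_free B (underlying G) -> (0 < #|val G|)%N ->
  Num.sqrt ((2 * C) `^ (- p^-1) / 2) * #|val G|%:R `^ ((1 + p^-1) / 2) <=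
  \sum_v Num.sqrt (degree G v)%:R.
Proof.
move=> p0 C0 exB Gfree mpos.
set m := #|val G|%:R : R; have m0 : 0 < m by rewrite ltr0n.
pose q v := Num.sqrt (degree G v)%:R : R.
have qq v : (degree G v)%:R = q v * q v by rewrite -expr2 sqr_sqrtr.
have q0 v : 0 <= q v by exact: sqrtr_ge0.
set S := \sum_v _.
have S0 : 0 < S.
  rewrite lt_neqAle sumr_ge0 // andbT eq_sym; apply/eqP => /psumr_eq0P qz.
  have /card_gt0P[[x y] xyG] := mpos.
  have /eqP := qz (fun v _ => q0 v) x isT; rewrite sqrtr_eq0 leNgt ltr0n => /negP.
  by apply; apply/card_gt0P; exists y; rewrite finset.in_set xyG.
(* This threshold makes the bound t * S on the arcs meeting the complement of H
   equal to m / 2. *)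
pose t := m / (2 * S); have t0 : 0 < t by rewrite divr_gt0 // mulr_gt0.
pose H := [set v | t <= q v]%SET.
have HS : #|H|%:R <= S / t.
  rewrite ler_pdivlMr // mulr_natl -sumr_const /S.
  rewrite [leRHS](bigID (fun v => v \in H)) /=.
  apply: ler_wpDr; first exact: sumr_ge0.
  by apply: ler_sum => v; rewrite finset.in_set.
have low : (\sum_(v | v \notin H) degree G v)%:R <= m / 2.
  have -> : m / 2 = t * S by rewrite /t; field; rewrite gt_eqF.
  rewrite natr_sum /S [in leRHS](bigID (fun v => v \notin H)) /= mulrDr.
  apply: ler_wpDr; first by rewrite mulr_ge0 ?sumr_ge0 ?ltW.
  rewrite mulr_sumr.
  apply: ler_sum => v; rewrite finset.in_set -ltNge -/(q v) qq => /ltW vt.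
  by rewrite ler_wpM2r.
have := card_arcs_le G H; rewrite -(ler_nat R) natrD -/m => mle.
have within : m / 2 <= #|arcs_within G H|%:R by lra.
have Hpos : (0 < #|H|)%N.
  rewrite lt0n; apply/eqP => /eqP; rewrite cards_eq0 => /eqP H0.
  move: within; have -> : arcs_within G H = finset.set0.
    by apply/finset.setP => a; rewrite finset.in_set H0 !finset.in_set0 !andbF.
  by rewrite cards0; lra.
have key : m / (2 * C) <= (2 * S ^+ 2 / m) `^ p.
  have -> : 2 * S ^+ 2 / m = S / t by rewrite /t; field; rewrite !gt_eqF.
  rewrite ler_pdivrMr ?mulr_gt0 //.
  have : #|arcs_within G H|%:R <= C * #|H|%:R `^ p.
    by apply: le_trans (exB _ Hpos); rewrite ler_nat card_arcs_within.
  have : C * #|H|%:R `^ p <= C * (S / t) `^ p.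
    apply: ler_wpM2l; first exact: ltW.
    by apply: ge0_ler_powR; rewrite ?nnegrE ?(divr_ge0 (ltW S0) (ltW t0)) ?(ltW p0).
  lra.
have key2 : m `^ p^-1 * (2 * C) `^ (- p^-1) <= 2 * S ^+ 2 / m.
  have -> : m `^ p^-1 * (2 * C) `^ (- p^-1) = (m / (2 * C)) `^ p^-1.
    have C2 : 0 <= 2 * C by rewrite mulr_ge0 // ltW.
    rewrite (@powRM _ m) ?invr_ge0 ?(ltW m0) // -(powR_inv1 C2).
    by rewrite -powRrM mulN1r.
  have -> : 2 * S ^+ 2 / m = ((2 * S ^+ 2 / m) `^ p) `^ p^-1.
    by rewrite -powRrM divff ?gt_eqF // powRr1 // ltW //
       divr_gt0 // mulr_gt0 // exprn_gt0.
  apply: ge0_ler_powR => //; rewrite ?nnegrE ?invr_ge0 ?powR_ge0 ?(ltW p0) //.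
  by rewrite divr_ge0 ?mulr_ge0 ?(ltW m0) ?(ltW C0).
rewrite -ler_sqr ?nnegrE ?mulr_ge0 ?sqrtr_ge0 ?powR_ge0 ?(ltW S0) //.
rewrite exprMn sqr_sqrtr ?divr_ge0 ?powR_ge0 //.
rewrite -powR_mulrn ?powR_ge0 // -powRrM divfK // powRD; last first.
  by rewrite (gt_eqF m0) implybT.
rewrite powRr1 ?(ltW m0) //.
by move: key2; rewrite ler_pdivlMr //; lra.
Qed.

Theorem theorem1p4 (R : realType) (B : graph_family) (eps : R) :
  eps < 2 ->
  (fun n : nat => (extremal_number n B)%:R : R) =O_\oo
    (fun n : nat => n%:R `^ (2 - eps)) ->
  exists c : R, 0 < c /\
    forall (T : finType) (G : digraph T),
      family_free B (underlying G) ->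
      (beta G)%:R <= #|val G|%:R / 2
        - c * #|val G|%:R `^ (3 / 4 + eps / (4 * (2 - eps))).
Proof.
move=> eps2; set p := 2 - eps => exO.
have p0 : 0 < p by rewrite subr_gt0.
have [C C0 exB] := extremal_power_bound p0 exO.
have -> : 3 / 4 + eps / (4 * p) = (1 + p^-1) / 2.
  have -> : eps = 2 - p by rewrite /p; ring.
  by field; rewrite gt_eqF.
pose K := Num.sqrt ((2 * C) `^ (- p^-1) / 2).
exists (5 / 128 * K); split.
  by rewrite mulr_gt0 // sqrtr_gt0 divr_gt0 // powR_gt0 // mulr_gt0.
move=> T G Gfree; apply: le_trans (beta_le_sum_sqrt_degree R G) _.
rewrite lerD2l lerN2 -[leLHS]mulrA ler_pM2l //.
have [m0|mpos] := posnP #|val G|; last exact: (sum_sqrt_degree_ge p0 C0 exB Gfree mpos).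
rewrite m0 powR0 ?mulr0 ?sumr_ge0 //.
by rewrite gt_eqF // divr_gt0 // addr_gt0 // invr_gt0.
Qed.
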